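(* Let $(G_i,H_i)_{i\in I}$ be a family of pairs of nontrivial connected graphs. If the graphs $G_i$ have logarithmic diameter, i.e., there is a constant $c>0$ with $\mathrm{diam}(G_i)\le c\log|V(G_i)|$ for all $i\in I$, then the exponential graphs $G_i^{H_i}$ have logarithmic diameter, i.e., there is a constant $c'>0$ with $\mathrm{diam}\left(G_i^{H_i}\right)\le c'\log\left|V\left(G_i^{H_i}\right)\right|$ for all $i\in I$.
   Context: A graph means a finite simple undirected graph with at least one vertex; it is nontrivial if it has at least two vertices. The diameter $\mathrm{diam}(G)$ of a connected graph $G$ is the maximum distance between two vertices. Exponential graph: for graphs $G$ and $H$ with $V(H)=\{w_1,\ldots,w_q\}$, the exponential graph $G^H$ has vertex set $\{(u_1,\ldots,u_q;w_j) : u_i\in V(G)\ (1\le i\le q),\ 1\le j\le q\}$, and two vertices $(u_1,\ldots,u_q;w_j)$ and $(v_1,\ldots,v_q;w_k)$ are adjacent if and only if either ($j=k$, $u_jv_j\in E(G)$, and $u_i=v_i$ for all $i\ne j$) or ($j\neq k$, $w_jw_k\in E(H)$, and $u_i=v_i$ for all $i$). *)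

(* Defs.v *)
From mathcomp Require Import all_boot.

Set Implicit Arguments.
Unset Strict Implicit.
Unset Printing Implicit Defensive.

Record sgraph := SGraph {
  vertex :> finType;
  adj : rel vertex;
  adj_sym : symmetric adj;
  adj_irr : irreflexive adj;
  vertex_gt0 : 0 < #|vertex| }.

Definition nontrivial (G : sgraph) : Prop := 1 < #|G|.

Definition gconnected (G : sgraph) : Prop :=
  forall x y : G, connect (@adj G) x y.

Definition has_walk (G : sgraph) (x y : G) (n : nat) : bool :=
  [exists p : n.-tuple G, path (@adj G) x p && (last x p == y)].

(* The least length of a walk from x to y. Distances in a connected graph are
   smaller than #|G|, so the search is bounded by #|G|; the value is #|G| when
   y is not reachable from x. *)
Definition dist (G : sgraph) (x y : G) : nat :=
  find (has_walk x y) (iota 0 #|G|).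

Definition diam (G : sgraph) : nat := \max_(x : G) \max_(y : G) dist x y.

Lemma has_walkP (G : sgraph) (x y : G) (n : nat) :
  reflect (exists p : seq G, [/\ size p = n, path (@adj G) x p & last x p = y])
          (has_walk x y n).
Proof.
apply: (iffP existsP) => [[p /andP[hp /eqP hl]]|[p [sp hp hl]]].
  by exists p; rewrite size_tuple.
by rewrite -sp; exists (in_tuple p); rewrite hp hl eqxx.
Qed.

Lemma distP (G : sgraph) (x y : G) : connect (@adj G) x y ->
  has_walk x y (dist x y) /\ forall n, has_walk x y n -> dist x y <= n.
Proof.
case/connectP => p0 hp0 ->; case/shortenP: hp0 => p hp up _.
have sp : size p < #|G| by apply: leq_trans (max_card [in x :: p]); rewrite (card_uniqP up).
have hw : has (has_walk x (last x p)) (iota 0 #|G|).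
  apply/hasP; exists (size p); first by rewrite mem_iota.
  by apply/has_walkP; exists p.
have hd := hw; rewrite has_find size_iota -/(dist x (last x p)) in hd.
split=> [|n hn].
  by have := nth_find 0 hw; rewrite nth_iota.
rewrite leqNgt; apply/negP => lt_n.
have := before_find 0 lt_n; rewrite nth_iota ?add0n ?hn //.
exact: ltn_trans hd.
Qed.

Section Exponential.
Variables G H : sgraph.

(* A vertex (u_1, ..., u_q; w_j) is the pair of the function w_i |-> u_i and
   of w_j: the coordinates are indexed by the vertices of H themselves. *)
Definition exp_vertex : finType := ({ffun H -> G} * H)%type.

Definition exp_adj (x y : exp_vertex) : bool :=
  [&& x.2 == y.2, adj (x.1 x.2) (y.1 x.2)
    & [forall i : H, (i != x.2) ==> (x.1 i == y.1 i)]]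
  || [&& x.2 != y.2, adj x.2 y.2 & [forall i : H, x.1 i == y.1 i]].

Lemma exp_adj_sym : symmetric exp_adj.
Proof.
suff sub x y : exp_adj x y -> exp_adj y x by move=> x y; apply/idP/idP => /sub.
case/orP=> /and3P[h1 h2 /forallP h3]; apply/orP; [left|right].
  rewrite eq_sym h1 -(eqP h1) adj_sym h2 /=.
  by apply/forallP => i; rewrite [y.1 i == _]eq_sym.
rewrite eq_sym h1 adj_sym h2 /=.
by apply/forallP => i; rewrite eq_sym.
Qed.

Lemma exp_adj_irr : irreflexive exp_adj.
Proof. by move=> x; rewrite /exp_adj !eqxx adj_irr. Qed.

Lemma exp_vertex_gt0 : 0 < #|exp_vertex|.
Proof.
by rewrite card_prod card_ffun muln_gt0 expn_gt0 !vertex_gt0.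
Qed.

Definition exp_graph : sgraph :=
  SGraph exp_adj_sym exp_adj_irr exp_vertex_gt0.

End Exponential.

Lemma exp_graph_connected (G H : sgraph) :
  gconnected G -> gconnected H -> gconnected (exp_graph G H).
Proof.
move=> cG cH.
pose C := connect (@exp_adj G H).
have moveH (u : {ffun H -> G}) (a b : H) : C (u, a) (u, b).
  case/connectP: (cH a b) => p; elim: p a => [|c p IHp] a /= => [_ ->|/andP[ac pc] lb].
    exact: connect0.
  apply: connect_trans (connect1 _) (IHp c pc lb).
  rewrite /exp_adj /= ac /= orbC; apply/orP; left; apply/andP; split.
    by apply: contraTneq ac => ->; rewrite adj_irr.
  by apply/forallP => i.
pose upd (u : {ffun H -> G}) (a : H) (s : G) : {ffun H -> G} :=
  [ffun i => if i == a then s else u i].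
have moveG (u : {ffun H -> G}) (a : H) (s : G) : C (u, a) (upd u a s, a).
  case/connectP: (cG (u a) s) => p.
  elim: p u => [|c p IHp] u /= => [_ ->|/andP[uc pc] ls].
    suff -> : upd u a (u a) = u by exact: connect0.
    by apply/ffunP => i; rewrite ffunE; case: eqP => // ->.
  have -> : upd u a s = upd (upd u a c) a s.
    by apply/ffunP => i; rewrite !ffunE; case: eqP.
  apply: connect_trans (connect1 _) (IHp _ _ _); rewrite ?ffunE ?eqxx //.
  rewrite /exp_adj /= eqxx ffunE eqxx uc /=; apply/orP; left.
  by apply/forallP => i; apply/implyP => /negPf ia; rewrite ffunE ia.
move=> [u a] [v b]; rewrite -[connect _ _ _]/(C _ _).
pose w (r : seq H) : {ffun H -> G} := [ffun i => if i \in r then v i else u i].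
have wr r : C (u, a) (w r, a).
  elim: r => [|c r IHr].
    suff -> : w [::] = u by exact: connect0.
    by apply/ffunP => i; rewrite ffunE.
  have -> : w (c :: r) = upd (w r) c (v c).
    by apply/ffunP => i; rewrite !ffunE inE; case: eqP => // ->.
  apply: connect_trans IHr _; apply: connect_trans (moveH _ a c) _.
  exact: connect_trans (moveG _ c _) (moveH _ c a).
have wv : w (enum H) = v by apply/ffunP => i; rewrite ffunE mem_enum.
by have := wr (enum H); rewrite wv => /connect_trans; apply; apply: moveH.
Qed.

(* Main.v *)
Require Import Defs.
From mathcomp Require Import all_boot all_order all_algebra.
From mathcomp Require Import reals exp.

Set Implicit Arguments.
Unset Strict Implicit.
Unset Printing Implicit Defensive.

Import Order.TTheory GRing.Theory Num.Theory.
Local Open Scope ring_scope.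

(** A vertex [(u; a)] reaches [(v; b)] by following a walk of H from a to b
  through all vertices of H, correcting the coordinate at w along a geodesic
  of G when w is visited. A connected graph on q vertices has a closed covering
  walk of length at most 2(q - 1), so diam (G^H) <= 3 q + q diam G. Since
  |V(G^H)| = q n^q with n = |V(G)| >= 2, its logarithm is at least q ln n, which
  absorbs both terms. *)

Section Walks.
Local Open Scope nat_scope.
Variable G : sgraph.
Implicit Types x y z : G.

Lemma has_walk0 x : has_walk x x 0.
Proof. by apply/has_walkP; exists [::]. Qed.

Lemma has_walk1 x y : adj x y -> has_walk x y 1.
Proof. by move=> xy; apply/has_walkP; exists [:: y]; rewrite /= xy. Qed.

Lemma has_walk_trans x y z m n :
  has_walk x y m -> has_walk y z n -> has_walk x z (m + n).
Proof.
move=> /has_walkP[p [<- xp <-]] /has_walkP[p' [<- xp' <-]].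
by apply/has_walkP; exists (p ++ p'); rewrite size_cat cat_path last_cat xp.
Qed.

Lemma dist_le x y n : has_walk x y n -> dist x y <= n.
Proof.
move=> xy; have /distP[_] : connect (@adj G) x y; last exact.
by have /has_walkP[p [_ xp <-]] := xy; apply/connectP; exists p.
Qed.

Lemma distxx x : dist x x = 0.
Proof. by apply/eqP; rewrite -leqn0 dist_le ?has_walk0. Qed.

Lemma dist_le_card x y : dist x y <= #|G|.
Proof. by apply: leq_trans (find_size _ _) _; rewrite size_iota. Qed.

Lemma dist_le_diam x y : dist x y <= diam G.
Proof.
apply: leq_trans (leq_bigmax (F := fun x => \max_(y : G) dist x y) x).
exact: (leq_bigmax (F := dist x)).
Qed.

Lemma diam_le n : (forall x y, dist x y <= n) -> diam G <= n.
Proof. by move=> le_n; apply/bigmax_leqP => x _; apply/bigmax_leqP. Qed.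

(** The first edge of a path along which [A] is left; it supplies the next vertex when a covering
    walk is grown. *)
Lemma connect_boundary x y (A : {pred G}) :
  connect (@adj G) x y -> x \in A -> y \notin A ->
  exists s t, [/\ s \in A, t \notin A & adj s t].
Proof.
case/connectP=> p; elim: p x => [|c p IHp] x /= => [_ -> -> //|].
case/andP=> xc cp yE xA yA; have [cA|cA] := boolP (c \in A).
  exact: IHp cp yE cA yA.
by exists x, c.
Qed.

(** A closed walk is grown from the trivial one: each new vertex is reached by a back-and-forth
    detour of two steps, so no spanning tree has to be built. *)
Lemma covering_closed_walk x : gconnected G ->
  exists p, [/\ path (@adj G) x p, last x p = x, size p <= 2 * #|G|
              & forall y, y \in x :: p].
Proof.
move=> cG.
have grow k : k < #|G| -> exists p, [/\ path (@adj G) x p, last x p = x,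
    size p <= 2 * k & k < #|[in x :: p]|].
  elim: k => [|k IHk] ltk.
    by exists [::]; split=> //; apply/card_gt0P; exists x; rewrite !inE.
  have [p [xp lp sp kp]] := IHk (ltnW ltk).
  (* A walk that already visits enough vertices is kept; otherwise it visits at most [k.+1 < #|G|]
     of them and misses some [y]. *)
  have [kp'|kp'] := ltnP k.+1 #|[in x :: p]|.
    by exists p; split=> //; apply: leq_trans sp _; rewrite leq_mul2l leqnSn orbT.
  have /existsP[y yp] : [exists y, y \notin x :: p].
    rewrite -negb_forall; apply: contraL ltk => /forallP all_p.
    by rewrite -leqNgt -(@eq_card _ [in x :: p] G).
  have [s [t [sA tA st]]] :=
    connect_boundary (A := [in x :: p]) (cG x y) (mem_head x p) yp.
  have {}sA : s \in x :: p := sA; have {}tA : t \notin x :: p := tA.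
  case/splitPl: sA xp lp sp kp tA {kp' yp} => p1 p2 ls.
  rewrite cat_path last_cat ls => /andP[xp1 sp2] lp sp kp tA.
  (* The walk is cut at an occurrence of [s] and the detour [s], [t], [s] is inserted there. *)
  exists (p1 ++ t :: s :: p2); split.
  - by rewrite cat_path /= ls xp1 st adj_sym st.
  - by rewrite last_cat.
  - by move: sp; rewrite !size_cat /= !addnS mulnS.
  apply: leq_ltn_trans kp _; apply: proper_card; apply/properP; split.
    apply/subsetP => z; rewrite !inE !mem_cat !inE.
    by case/or3P=> ->; rewrite ?orbT.
  exists t; last exact: tA.
  by rewrite !inE mem_cat mem_head !orbT.
have [|p [xp lp sp kp]] := grow #|G|.-1; first by rewrite prednK ?vertex_gt0.
exists p; split=> // [|y]; first by apply: leq_trans sp _; rewrite leq_mul2l leq_pred.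
rewrite prednK ?vertex_gt0 // in kp.
have /subset_leqif_card/geq_leqif : [in x :: p] \subset G by exact/subsetP.
by rewrite kp => /esym/subsetP/(_ y)-> //.
Qed.

End Walks.

Section ExponentialWalks.
Local Open Scope nat_scope.
Variables G H : sgraph.
Hypothesis cG : gconnected G.
Implicit Types (u v : {ffun H -> G}) (a b : H).

Definition set_coord u a (s : G) : {ffun H -> G} :=
  [ffun i => if i == a then s else u i].

Lemma exp_walk_base u a b :
  adj a b -> has_walk ((u, a) : exp_graph G H) (u, b) 1.
Proof.
move=> ab; apply: has_walk1; rewrite /= /exp_adj /= ab orbC /=.
rewrite (contraTneq _ ab) => [|->]; last by rewrite adj_irr.
by rewrite (_ : [forall i, _]) //; apply/forallP.
Qed.

(** While the base point stays at [a], a geodesic of [G] from [u a] to [s] lifts step by step to the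
    exponential graph. *)
Lemma exp_walk_coord u a (s : G) :
  has_walk ((u, a) : exp_graph G H) (set_coord u a s, a) (dist (u a) s).
Proof.
have [/has_walkP[p [<- up ls]] _] := distP (cG (u a) s).
elim: p u up ls => [|c p IHp] u /= => [_ <-|/andP[uc cp] ls].
  suff -> : set_coord u a (u a) = u by exact: has_walk0.
  by apply/ffunP => i; rewrite ffunE; case: eqP => // ->.
have -> : set_coord u a s = set_coord (set_coord u a c) a s.
  by apply/ffunP => i; rewrite !ffunE; case: eqP.
rewrite -add1n; apply: has_walk_trans (IHp _ _ _); rewrite ?ffunE ?eqxx //.
apply: has_walk1; rewrite /= /exp_adj /= eqxx ffunE eqxx uc /=.
apply/orP; left; apply/forallP => i; apply/implyP => /negPf ia.
by rewrite ffunE ia.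
Qed.

(** Each coordinate is corrected at the first visit of its vertex, so the sum counts it once even if
    the walk returns there. Asking for agreement off the walk makes the induction on [p]
    possible. *)
Lemma exp_walk_along u v a (p : seq H) :
    path (@adj H) a p -> (forall i, i \notin a :: p -> u i = v i) ->
  has_walk ((u, a) : exp_graph G H) (v, last a p)
    (size p + \sum_i dist (u i) (v i)).
Proof.
elim: p u a => [|b p IHp] u a /= => [_|/andP[ab bp]] uv;
  rewrite (bigD1 a) //=.
  rewrite big1 ?addn0 => [|i ia]; last by rewrite uv ?distxx // inE.
  suff vE : set_coord u a (v a) = v.
    by have := exp_walk_coord u a (v a); rewrite vE.
  apply/ffunP => i; rewrite ffunE; case: eqVneq => [-> //|ia].
  by rewrite uv // inE.
pose u' := set_coord u a (v a).
have u'E i : i != a -> u' i = u i by move=> /negPf ia; rewrite ffunE ia.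
rewrite addnCA addSn -add1n.
apply: has_walk_trans (exp_walk_coord u a (v a)) _.
apply: has_walk_trans (exp_walk_base _ ab) _.
(* The coordinate at [a] is now correct, so its term vanishes from the sum given by the induction
   hypothesis. *)
have := IHp u' b bp; rewrite (bigD1 a) //= ffunE eqxx distxx add0n.
rewrite (eq_bigr (fun i => dist (u i) (v i))) => [|i /u'E-> //].
apply=> i ip; have [->|ia] := eqVneq i a; first by rewrite ffunE eqxx.
by rewrite u'E // uv // inE negb_or ia.
Qed.

(** In the constant 3, two units of [#|H|] pay for the closed covering walk at [a] and one for the
    geodesic from [a] to [b] appended to it. *)
Lemma diam_exp_graph : gconnected H ->
  diam (exp_graph G H) <= #|H| * (3 + diam G).
Proof.
move=> cH; apply: diam_le => -[u a] [v b].
have [p [ap la sp cov]] := covering_closed_walk a cH.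
have [/has_walkP[p' [sp' bp' lb]] _] := distP (cH a b).
have := @exp_walk_along u v a (p ++ p').
rewrite cat_path last_cat la lb ap bp' size_cat => /(_ isT) walk.
apply: leq_trans (dist_le (walk _)) _ => [i|].
  by rewrite -cat_cons mem_cat cov.
rewrite mulnDr leq_add //.
  by rewrite mulnC -[3]/(2 + 1) mulnDl mul1n leq_add // sp' dist_le_card.
by rewrite -sum_nat_const leq_sum // => i _; apply: dist_le_diam.
Qed.

Lemma card_exp_graph : #|exp_graph G H| = #|G| ^ #|H| * #|H|.
Proof. by rewrite card_prod card_ffun. Qed.

End ExponentialWalks.

Theorem theorem2 (R : realType) (I : Type) (G H : I -> sgraph)
    (ntG : forall i, nontrivial (G i)) (cnG : forall i, gconnected (G i))
    (ntH : forall i, nontrivial (H i)) (cnH : forall i, gconnected (H i)) :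
  (exists2 c : R, 0 < c &
     forall i, (diam (G i))%:R <= c * ln (#|G i|%:R)) ->
  exists2 c' : R, 0 < c' &
     forall i, (diam (exp_graph (G i) (H i)))%:R
                 <= c' * ln (#|exp_graph (G i) (H i)|%:R).
Proof.
case=> c c_gt0 diamG.
have ln2_gt0 : 0 < ln 2 :> R by rewrite ln_gt0 // ltr1n.
have c'_gt0 : 0 < 3 / ln 2 + c by rewrite addr_gt0 ?divr_gt0.
(* The summand [3 / ln 2] absorbs [3 * #|H i|] because [ln 2 <= ln #|G i|]; the summand [c] absorbs
   [#|H i| * diam (G i)]. *)
exists (3 / ln 2 + c) => // i.
have n_gt0 : 0 < #|G i|%:R :> R by rewrite ltr0n vertex_gt0.
have q_gt0 : 0 < #|H i|%:R :> R by rewrite ltr0n vertex_gt0.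
have le_ln2 : ln 2 <= ln #|G i|%:R :> R.
  by rewrite ler_ln ?posrE // ler_nat; apply: ntG.
apply: (@le_trans _ _ (#|H i| * (3 + diam (G i)))%:R).
  by rewrite ler_nat diam_exp_graph.
apply: (@le_trans _ _ ((3 / ln 2 + c) * (#|H i|%:R * ln #|G i|%:R))).
  rewrite mulrCA natrM ler_wpM2l ?ler0n // natrD mulrDl lerD //.
  by rewrite mulrAC ler_pdivlMr // ler_wpM2l.
rewrite ler_wpM2l ?(ltW c'_gt0) // card_exp_graph natrM natrX.
(* The logarithm splits as [#|H i| * ln #|G i| + ln #|H i|], and the last term is nonnegative. *)
rewrite lnM ?posrE ?exprn_gt0 // lnXn // mulr_natl lerDl.
by rewrite ln_ge0 // ler1n vertex_gt0.
Qed.
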